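(* For all $n\in\mathbb N$, with $i_n=\frac12(1-(-1)^n)$, the random walk $(X_n,Y_n)$ on the hexagonal lattice started at the origin satisfies $$\mathbb E(X_n)=\mu_1n+\theta_1i_n,\qquad \mathbb E(Y_n)=\mu_2n+\theta_2i_n,$$ $$Var(X_n)=\sigma_1^2n+\theta_3i_n,\qquad Var(Y_n)=\sigma_2^2n+\theta_4i_n,\qquad Cov(X_n,Y_n)=\sigma_{1,2}n+\theta_5i_n,$$ where $$\mu_1=\tfrac34a[(q_{1,1}+q_{1,2})-(q_{0,1}+q_{0,2})],\qquad \theta_1=a-\tfrac34a[(q_{1,1}+q_{1,2})+(q_{0,1}+q_{0,2})],$$ $$\mu_2=\tfrac{\sqrt3}{4}a[(q_{0,1}-q_{0,2})-(q_{1,1}-q_{1,2})],\qquad \theta_2=\tfrac{\sqrt3}{4}a[(q_{0,1}-q_{0,2})+(q_{1,1}-q_{1,2})],$$ $$\sigma_1^2=\tfrac98a^2[(q_{0,1}+q_{0,2})-(q_{0,1}+q_{0,2})^2+(q_{1,1}+q_{1,2})-(q_{1,1}+q_{1,2})^2],$$ $$\theta_3=\tfrac98a^2[(q_{0,1}+q_{0,2})-(q_{0,1}+q_{0,2})^2-(q_{1,1}+q_{1,2})+(q_{1,1}+q_{1,2})^2],$$ $$\sigma_2^2=\tfrac38a^2[(q_{0,1}+q_{0,2})-(q_{0,1}-q_{0,2})^2+(q_{1,1}+q_{1,2})-(q_{1,1}-q_{1,2})^2],$$ $$\theta_4=\tfrac38a^2[(q_{0,1}+q_{0,2})-(q_{0,1}-q_{0,2})^2-(q_{1,1}+q_{1,2})+(q_{1,1}-q_{1,2})^2],$$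 $$\sigma_{1,2}=\tfrac{3\sqrt3}{8}a^2[q_{0,1}(q_{0,1}-1)+q_{0,2}(1-q_{0,2})-q_{1,1}(1-q_{1,1})+q_{1,2}(1-q_{1,2})],$$ $$\theta_5=\tfrac{3\sqrt3}{8}a^2[q_{0,1}(q_{0,1}-1)+q_{0,2}(1-q_{0,2})+q_{1,1}(1-q_{1,1})-q_{1,2}(1-q_{1,2})].$$
   Context: Fix $a>0$ and nonnegative numbers $q_{i,r}$ ($i=0,1$; $r=0,1,2$) with $\sum_{r=0}^2 q_{i,r}=1$ for $i=0,1$. The vertices of the hexagonal lattice are $\mathscr V_0\cup\mathscr V_1$, where $$\mathscr V_i=\left\{\left(\tfrac32 aj+ia,\ \tfrac{\sqrt3}{2}aj+\sqrt3 ak\right): j,k\in\mathbb Z\right\},\quad i=0,1.$$ $\{(X_n,Y_n):n\in\mathbb N_0\}$ is the time-homogeneous Markov chain on $\mathscr V_0\cup\mathscr V_1$ which, from a vertex $(x,y)\in\mathscr V_i$, moves in one step to $\left(x+a\cos(\tfrac{2\pi r}{3}+i\pi),\ y+a\sin(\tfrac{2\pi r}{3}+i\pi)\right)$ with probability $q_{i,r}$, $r=0,1,2$ (such a point belongs to $\mathscr V_{1-i}$). The initial condition is $(X_0,Y_0)=(0,0)$ almost surely. *)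

(* Defs.v *)
From HB Require Import structures.
From mathcomp Require Import all_boot all_order all_algebra.
From mathcomp Require Import all_classical all_reals all_analysis.
Set Implicit Arguments.
Unset Strict Implicit.
Unset Printing Implicit Defensive.
Import Order.TTheory GRing.Theory Num.Theory.
Import numFieldNormedType.Exports.

Local Open Scope classical_set_scope.
Local Open Scope ring_scope.

(* P(A | B); only meaningful when P B != 0. *)
Definition cond_prob (d : measure_display) (T : measurableType d)
    (R : realType) (P : probability T R) (A B : set T) : R :=
  fine (P (A `&` B)) / fine (P B).

Definition markov_property (d : measure_display) (T : measurableType d)
    (R : realType) (P : probability T R) (S : Type) (Z : nat -> T -> S) : Prop :=
  forall (n : nat) (u : nat -> S) (v : S),
    P [set t | forall k, (k <= n)%N -> Z k t = u k] != 0%E ->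
    cond_prob P [set t | Z n.+1 t = v]
                [set t | forall k, (k <= n)%N -> Z k t = u k]
    = cond_prob P [set t | Z n.+1 t = v] [set t | Z n t = u n].

Definition hex_vertices (R : realType) (a : R) (i : 'I_2) : set (R * R) :=
  [set p | exists j k : int,
     p = (3 / 2 * a * j%:~R + i%:R * a,
          Num.sqrt 3 / 2 * a * j%:~R + Num.sqrt 3 * a * k%:~R)].

Definition hex_step (R : realType) (a : R) (i : 'I_2) (r : 'I_3)
    (p : R * R) : R * R :=
  (p.1 + a * cos (2 * pi * r%:R / 3 + i%:R * pi),
   p.2 + a * sin (2 * pi * r%:R / 3 + i%:R * pi)).

(* The numbers [q i 0], [q i 1], [q i 2] are the transition probabilities out of
   the vertices of class [i]; they do not depend on the time [n]. *)
Record hex_walk (R : realType) (a : R) (q : 'I_2 -> 'I_3 -> R)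
    (d : measure_display) (T : measurableType d) (P : probability T R)
    (X Y : nat -> {RV P >-> R}) : Prop := HexWalk {
  hex_walk_vertices : forall n t,
    (hex_vertices a 0 `|` hex_vertices a 1) (X n t, Y n t) ;
  hex_walk_markov : markov_property P (fun n t => (X n t, Y n t)) ;
  hex_walk_transition : forall (n : nat) (i : 'I_2) (r : 'I_3) (p : R * R),
    hex_vertices a i p ->
    P [set t | (X n t, Y n t) = p] != 0%E ->
    cond_prob P [set t | (X n.+1 t, Y n.+1 t) = hex_step a i r p]
                [set t | (X n t, Y n t) = p] = q i r ;
  hex_walk_init : {ae P, forall t, (X 0%N t, Y 0%N t) = (0, 0)}
}.

Section Coefficients.
Variables (R : realType) (a : R) (q : 'I_2 -> 'I_3 -> R).

Definition mu1 : R :=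
  3 / 4 * a * ((q 1 1 + q 1 2) - (q 0 1 + q 0 2)).
Definition theta1 : R :=
  a - 3 / 4 * a * ((q 1 1 + q 1 2) + (q 0 1 + q 0 2)).
Definition mu2 : R :=
  Num.sqrt 3 / 4 * a * ((q 0 1 - q 0 2) - (q 1 1 - q 1 2)).
Definition theta2 : R :=
  Num.sqrt 3 / 4 * a * ((q 0 1 - q 0 2) + (q 1 1 - q 1 2)).
Definition sigma1_sq : R :=
  9 / 8 * a ^+ 2 * ((q 0 1 + q 0 2) - (q 0 1 + q 0 2) ^+ 2
                    + (q 1 1 + q 1 2) - (q 1 1 + q 1 2) ^+ 2).
Definition theta3 : R :=
  9 / 8 * a ^+ 2 * ((q 0 1 + q 0 2) - (q 0 1 + q 0 2) ^+ 2
                    - (q 1 1 + q 1 2) + (q 1 1 + q 1 2) ^+ 2).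
Definition sigma2_sq : R :=
  3 / 8 * a ^+ 2 * ((q 0 1 + q 0 2) - (q 0 1 - q 0 2) ^+ 2
                    + (q 1 1 + q 1 2) - (q 1 1 - q 1 2) ^+ 2).
Definition theta4 : R :=
  3 / 8 * a ^+ 2 * ((q 0 1 + q 0 2) - (q 0 1 - q 0 2) ^+ 2
                    - (q 1 1 + q 1 2) + (q 1 1 - q 1 2) ^+ 2).
Definition sigma12 : R :=
  3 * Num.sqrt 3 / 8 * a ^+ 2
  * (q 0 1 * (q 0 1 - 1) + q 0 2 * (1 - q 0 2)
     - q 1 1 * (1 - q 1 1) + q 1 2 * (1 - q 1 2)).
Definition theta5 : R :=
  3 * Num.sqrt 3 / 8 * a ^+ 2
  * (q 0 1 * (q 0 1 - 1) + q 0 2 * (1 - q 0 2)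
     + q 1 1 * (1 - q 1 1) - q 1 2 * (1 - q 1 2)).

End Coefficients.

Definition parity_coef (R : realType) (n : nat) : R := (1 - (-1) ^+ n) / 2.

(* Main.v *)
(** The class of the current vertex is the parity of the time, so one step from
    time [n] adds to [(X_n, Y_n)] an increment whose law given the position only
    depends on the parity of [n].  Hence means and covariances are sums over
    [m < n] of the means and covariances of the increments, which alternate
    between two values.  All laws have finite support, so expectations reduce to
    the recursion [hex_mean]; only the one-step transition probabilities enter. *)
Require Import Defs.
From mathcomp Require Import all_boot all_order all_algebra.
From mathcomp Require Import all_classical all_reals all_analysis.
From mathcomp Require Import measurable_realfun ring lra.
Set Implicit Arguments.
Unset Strict Implicit.
Unset Printing Implicit Defensive.
Import Order.TTheory GRing.Theory Num.Theory.
Local Open Scope ring_scope.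

(** * Expectations under a finitely supported law *)

Section FiniteSupport.
Variables (d : measure_display) (T : measurableType d) (R : realType).
Variables (P : probability T R) (S : eqType) (Z : T -> S).
Hypothesis mZ : forall p, measurable [set t | Z t = p]%classic.

Lemma preimage_mem_cons p s :
  [set t | Z t \in p :: s]%classic =
  ([set t | Z t = p] `|` [set t | Z t \in s])%classic.
Proof.
apply/seteqP; split=> t /=; rewrite inE.
  by move=> /orP[/eqP|]; [left|right].
by move=> [->|->]; rewrite ?eqxx ?orbT.
Qed.

Lemma measurable_preimage_mem (s : seq S) : measurable [set t | Z t \in s]%classic.
Proof.
elim: s => [|p s IH].
  by rewrite (_ : [set _ | _]%classic = set0)//; apply/seteqP; split.
by rewrite preimage_mem_cons; exact: measurableU.
Qed.

Lemma probability_mem (s : seq S) : uniq s ->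
  P [set t | Z t \in s]%classic = (\sum_(p <- s) P [set t | Z t = p]%classic)%E.
Proof.
elim: s => [_|p s IH /= /andP[ps us]].
  by rewrite big_nil (_ : [set _ | _]%classic = set0) ?measure0//; apply/seteqP; split.
rewrite big_cons -IH// preimage_mem_cons measureU//.
  exact: measurable_preimage_mem.
by apply/seteqP; split=> t //= [->]; rewrite (negbTE ps).
Qed.

Lemma fine_probability_mem (s : seq S) : uniq s ->
  fine (P [set t | Z t \in s]%classic) =
  \sum_(p <- s) fine (P [set t | Z t = p]%classic).
Proof.
move=> us; apply: EFin_inj; rewrite fineK ?fin_num_measure//; last first.
  exact: measurable_preimage_mem.
rewrite probability_mem// -sumEFin; apply: eq_bigr => p _.
by rewrite fineK// fin_num_measure.
Qed.

(** [f \o Z] agrees almost surely with the simple function that weights the indicator of each event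
    [Z t = p] by [f p]. As [S] carries no sigma-algebra, measurability of [f \o Z] is a separate
    hypothesis. *)
Lemma expectation_finite_support (s : seq S) (f : S -> R) : uniq s ->
    P [set t | Z t \in s]%classic = 1%E -> measurable_fun setT (f \o Z) ->
  'E_P[f \o Z]%E = (\sum_(p <- s) f p * fine (P [set t | Z t = p]%classic))%:E.
Proof.
move=> us Ps mf; rewrite unlock.
have mI p : measurable_fun [set: T]
    (EFin \o (fun t => f p * \1_[set t | Z t = p]%classic t : R)).
  by apply/measurable_EFinP; apply: measurable_funM => //; exact: measurable_indic.
have iI p : P.-integrable setT (fun t => (f p * \1_[set t | Z t = p]%classic t)%:E).
  under eq_fun do rewrite EFinM.
  by apply: integrableZl => //; exact: integrable_indic.
rewrite (@ae_eq_integral _ _ _ P setT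
  (fun t => \sum_(p <- s) (f p * \1_[set t | Z t = p]%classic t)%:E)%E)//.
- rewrite integral_sum//; rewrite -sumEFin; apply: eq_bigr => p _.
  under eq_integral do rewrite EFinM.
  rewrite integralZl//; last exact: integrable_indic.
  by rewrite integral_indic// setIT EFinM fineK ?fin_num_measure.
- exact/measurable_EFinP.
- exact: emeasurable_sum.
- exists (~` [set t | Z t \in s])%classic; split.
  + by apply: measurableC; exact: measurable_preimage_mem.
  + by have := probability_setC P (measurable_preimage_mem s);
      rewrite Ps ?subee//; exact: measurable_preimage_mem.
  (* Where [Z t] lies in [s], only its own term survives, and it occurs once since [s] is
     duplicate-free. *)
  + move=> t /= + ts; apply => _; rewrite sumEFin.
    rewrite (bigD1_seq (Z t))//= indicE mem_set// mulr1 big1 ?addr0// => p pZ.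
    by rewrite indicE memNset ?mulr0//= => Zp; rewrite Zp eqxx in pZ.
Qed.

End FiniteSupport.

(** * The three directions of a step *)

Lemma cos_pi3 (R : realType) : cos (pi / 3) = 1 / 2 :> R.
Proof.
have pi0 := pi_gt0 R.
have c0 : 0 < cos (pi / 3 : R) by apply: cos_gt0_pihalf; apply/andP; split; lra.
have cs := cos2Dsin2 (pi / 3 : R).
(* With c = cos (pi / 3), the triple-angle formula at cos pi = -1 gives 4c^3 - 3c + 1 = (c + 1)(2c -
   1)^2 = 0, and c > 0 leaves c = 1/2. *)
have : cos (pi / 3 + (pi / 3 + pi / 3)) = -1 :> R by rewrite -cospi; congr cos; field.
rewrite cosD (cosD (pi / 3)) (sinD (pi / 3)).
move: (cos _) (sin _) c0 cs => c s c0 cs h.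
have /eqP : (c + 1) * (2 * c - 1) ^+ 2 = 0.
  have s2 : s ^+ 2 = 1 - c ^+ 2 by lra.
  have e : c * (c * c - s * s) - s * (s * c + c * s) = c ^+ 3 - 3 * c * s ^+ 2 by ring.
  have : c ^+ 3 - 3 * c * (1 - c ^+ 2) = -1 by rewrite -s2 -e.
  move=> k.
  have -> : (c + 1) * (2 * c - 1) ^+ 2 = c ^+ 3 - 3 * c * (1 - c ^+ 2) + 1 by ring.
  by rewrite k addNr.
rewrite mulf_eq0 expf_eq0 /= => /orP[|] /eqP; lra.
Qed.

Lemma sin_pi3 (R : realType) : sin (pi / 3) = Num.sqrt 3 / 2 :> R.
Proof.
have pi0 := pi_gt0 R.
have s0 : 0 < sin (pi / 3 : R) by apply: sin_gt0_pihalf; apply/andP; split; lra.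
have := cos2Dsin2 (pi / 3 : R); rewrite cos_pi3 => h.
apply/eqP; rewrite -(@eqrXn2 _ 2)// ?(ltW s0)// ?divr_ge0// ?sqrtr_ge0//.
by rewrite exprMn sqr_sqrtr//; apply/eqP; lra.
Qed.

(** Unit vector at angle 2 pi r / 3 in algebraic form, so that later identities are rational in the
    square root of 3. The last case is r = 2. *)
Definition hex_dir (R : realType) (r : 'I_3) : R * R :=
  match val r with
  | 0%N => (1, 0)
  | 1%N => (- (1 / 2), Num.sqrt 3 / 2)
  | _ => (- (1 / 2), - (Num.sqrt 3 / 2))
  end.

Lemma hex_stepE (R : realType) (a : R) (i : 'I_2) (r : 'I_3) (p : R * R) :
  hex_step a i r p = (p.1 + (-1) ^+ i * a * (hex_dir R r).1,
                      p.2 + (-1) ^+ i * a * (hex_dir R r).2).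
Proof.
have cs x : cos (x + i%:R * pi) = (-1) ^+ i * cos x /\
            sin (x + i%:R * pi) = (-1) ^+ i * sin x :> R.
  case: i => [[|[|//]]] /= _; rewrite ?mul0r ?addr0 ?expr0 ?mul1r//.
  by rewrite expr1 cosDpi sinDpi !mulN1r.
suff E : (cos (2 * pi * r%:R / 3), sin (2 * pi * r%:R / 3)) = hex_dir R r.
  by rewrite /hex_step !(cs _).1 !(cs _).2 -E/=; congr (_, _); ring.
case: r => [[|[|[|//]]]] ?; rewrite /hex_dir /=.
- by rewrite mulr0 mul0r cos0 sin0.
- have -> : 2 * pi * 1 / 3 = - (pi / 3) + pi :> R by field.
  by rewrite cosDpi sinDpi cosN sinN cos_pi3 sin_pi3 opprK.
- have -> : 2 * pi * 2 / 3 = pi / 3 + pi :> R by field.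
  by rewrite cosDpi sinDpi cos_pi3 sin_pi3.
Qed.

(** The first coordinate separates direction 0 from the other two, and the sign of the second
    separates these. *)
Lemma hex_step_inj (R : realType) (a : R) (i : 'I_2) (p : R * R) :
  a != 0 -> injective (fun r => hex_step a i r p).
Proof.
move=> a0 r r'; rewrite !hex_stepE => -[/addrI + /addrI].
have s0 : 0 < Num.sqrt (3 : R) by rewrite sqrtr_gt0.
have na : (-1) ^+ i * a != 0 by rewrite mulf_neq0// signr_eq0.
move=> /(mulfI na) + /(mulfI na).
case: r => [[|[|[|//]]]] ?; case: r' => [[|[|[|//]]]] ?; rewrite /hex_dir /= => *;
 by [exact: val_inj | exfalso; lra].
Qed.

(** * Alternating classes and the averaging recursion along them *)

Definition hex_class (n : nat) : 'I_2 := if odd n then 1 else 0.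

Lemma hex_step_class (R : realType) (a : R) (n : nat) (r : 'I_3) (p : R * R) :
  hex_vertices a (hex_class n) p ->
  hex_vertices a (hex_class n.+1) (hex_step a (hex_class n) r p).
Proof.
rewrite hex_stepE /hex_class /=; case: (odd n) => /= -[j [k ->]];
  case: r => [[|[|[|//]]]] ?; rewrite /hex_vertices /hex_dir /=
    ?(modn_small (ltnSn 1)) ?expr1 ?expr0.
(* Odd times come first and lead from class 1 to class 0. Direction 0 keeps (j, k); the others move
   j to j + 1 from class 1 and to j - 1 from class 0, and direction 1 also shifts k the opposite
   way. *)
- by exists j, k; congr (_, _); field.
- by exists (j + 1), (k - 1); rewrite !rmorphD rmorphN/=; congr (_, _); field.
- by exists (j + 1), k; rewrite !rmorphD /=; congr (_, _); field.
- by exists j, k; congr (_, _); field.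
- by exists (j - 1), (k + 1); rewrite !rmorphD !rmorphN/=; congr (_, _); field.
- by exists (j - 1), k; rewrite !rmorphD !rmorphN/=; congr (_, _); field.
Qed.

(** The expectation of f(X_n, Y_n) with the last step averaged out first: the function changes along
    the recursion while the time decreases. It makes sense for arbitrary [f], without a probability
    space. *)
Fixpoint hex_mean (R : realType) (a : R) (q : 'I_2 -> 'I_3 -> R) (n : nat)
    (f : R * R -> R) : R :=
  if n is m.+1 then
    \sum_(r < 3) q (hex_class m) r * hex_mean a q m (f \o hex_step a (hex_class m) r)
  else f (0, 0).

Section HexMean.
Variables (R : realType) (a : R) (q : 'I_2 -> 'I_3 -> R).
Hypothesis q_sum1 : forall i, \sum_(r < 3) q i r = 1.
Implicit Types (n : nat) (f g : R * R -> R) (c e : 'I_2 -> 'I_3 -> R).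

Lemma eq_hex_mean n f g : f =1 g -> hex_mean a q n f = hex_mean a q n g.
Proof. by move/funext ->. Qed.

Lemma hex_meanD n f g :
  hex_mean a q n (fun p => f p + g p) = hex_mean a q n f + hex_mean a q n g.
Proof.
elim: n f g => //= n IH f g; rewrite -big_split/=; apply: eq_bigr => r _.
by rewrite -mulrDr -IH.
Qed.

Lemma hex_meanZ n k f : hex_mean a q n (fun p => k * f p) = k * hex_mean a q n f.
Proof.
elim: n f => //= n IH f; rewrite mulr_sumr; apply: eq_bigr => r _.
by rewrite mulrCA -IH.
Qed.

Lemma hex_mean_cst n k : hex_mean a q n (fun=> k) = k.
Proof.
elim: n => //= n IH; rewrite -[RHS]mul1r -(q_sum1 (hex_class n)) mulr_suml.
by apply: eq_bigr => r _; rewrite -[in RHS]IH.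
Qed.

(** The increment [c i r] does not depend on the position, so the last step adds its mean to the
    mean already accumulated. *)
Lemma hex_mean_additive n f c :
    (forall i r p, f (hex_step a i r p) = f p + c i r) -> f (0, 0) = 0 ->
  hex_mean a q n f = \sum_(m < n) \sum_(r < 3) q (hex_class m) r * c (hex_class m) r.
Proof.
move=> fc f0; elim: n => [|n IH]; first by rewrite big_ord0.
rewrite big_ord_recr /= -IH -[X in _ = X + _]mul1r -(q_sum1 (hex_class n)) mulr_suml.
rewrite -big_split /=; apply: eq_bigr => r _; rewrite -mulrDr; congr (_ * _).
by rewrite -[X in _ = _ + X](hex_mean_cst n) -hex_meanD; apply: eq_hex_mean => p /=.
Qed.

(* The deviations of f and g from their means are orthogonal to the constants,
   so the covariance of the new increments is all that a step adds. *)
Lemma hex_mean_cov n f g c e :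
    (forall i r p, f (hex_step a i r p) = f p + c i r) ->
    (forall i r p, g (hex_step a i r p) = g p + e i r) ->
    f (0, 0) = 0 -> g (0, 0) = 0 ->
  hex_mean a q n (fun p => (f p - hex_mean a q n f) * (g p - hex_mean a q n g)) =
  \sum_(m < n) (\sum_(r < 3) q (hex_class m) r * (c (hex_class m) r * e (hex_class m) r)
    - (\sum_(r < 3) q (hex_class m) r * c (hex_class m) r)
      * (\sum_(r < 3) q (hex_class m) r * e (hex_class m) r)).
Proof.
move=> fc ge f0 g0; elim: n => [|n IH].
  by rewrite big_ord0 /= f0 g0 subrr mul0r.
have mS h k : (forall i r p, h (hex_step a i r p) = h p + k i r) -> h (0, 0) = 0 ->
    hex_mean a q n.+1 h =
    hex_mean a q n h + \sum_(r < 3) q (hex_class n) r * k (hex_class n) r.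
  by move=> hk h0; rewrite !(hex_mean_additive _ hk h0) big_ord_recr.
rewrite (mS _ _ fc f0) (mS _ _ ge g0) [in RHS]big_ord_recr -{}IH {mS} /=.
move: (hex_class n) => i; set mf := hex_mean a q n f.
set mg := hex_mean a q n g; set S := hex_mean a q n (fun p => (f p - mf) * (g p - mg)).
set C := \sum_(r < 3) _ * c i r.
set E := \sum_(r < 3) _ * e i r.
have step r : hex_mean a q n
    ((fun p => (f p - (mf + C)) * (g p - (mg + E))) \o hex_step a i r)
    = S + (c i r - C) * (e i r - E).
  (* Expanding around the old means [mf] and [mg] leaves terms linear in the deviations of [f] and
     [g], which average to zero. *)
  rewrite (@eq_hex_mean _ _ (fun p => (f p - mf) * (g p - mg) +
     ((c i r - C) * g p + ((e i r - E) * f p +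
       ((c i r - C) * (e i r - E) - (c i r - C) * mg - (e i r - E) * mf))))).
    by rewrite !hex_meanD !hex_meanZ !hex_mean_cst -/mf -/mg -/S; ring.
  by move=> p /=; rewrite fc ge; ring.
under eq_bigr do rewrite step.
(* Inserting the total weight 1 as a sum, where the expansion produces it, turns the goal into a
   polynomial identity in the weights. *)
have : \sum_(r < 3) q i r * (c i r * e i r) - C * E =
    \sum_(r < 3) q i r * (c i r * e i r) - C * E - E * C + C * E * \sum_(r < 3) q i r.
  by rewrite q_sum1; ring.
move=> ->; rewrite -[S in RHS]mul1r -(q_sum1 i) /C /E.
by rewrite !big_ord_recl !big_ord0; ring.
Qed.

End HexMean.

(** With i_n the parity coefficient, there are (n + i_n)/2 even and (n - i_n)/2 odd times below n.
    Half-sums thus give the slopes mu and sigma, half-differences the corrections theta. *)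
Lemma sum_hex_class (R : realType) (k : 'I_2 -> R) (n : nat) :
  \sum_(m < n) k (hex_class m) =
  (k 0 + k 1) / 2 * n%:R + (k 0 - k 1) / 2 * parity_coef R n.
Proof.
rewrite /parity_coef -signr_odd.
elim: n => [|n IH]; first by rewrite big_ord0 /= expr0 subrr; ring.
rewrite big_ord_recr /= IH -(natr1 n) /hex_class /=.
by case: (odd n) => /=; rewrite ?expr0 ?expr1; field.
Qed.

(** * The law of the walk *)

Section Walk.
Variables (R : realType) (a : R) (q : 'I_2 -> 'I_3 -> R).
Variables (d : measure_display) (T : measurableType d) (P : probability T R).
Variables (X Y : nat -> {RV P >-> R}).
Hypothesis a_gt0 : 0 < a.
Hypothesis q_sum1 : forall i, \sum_(r < 3) q i r = 1.
Hypothesis XY_walk : hex_walk a q X Y.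

Let Z n t := (X n t, Y n t).
Let step n r := hex_step a (hex_class n) r.

Lemma measurable_walk n : measurable_fun [set: T] (Z n).
Proof. by apply/measurable_fun_pair; exact: measurable_funPT. Qed.

Lemma measurable_walk_eq n p : measurable [set t | Z n t = p]%classic.
Proof.
rewrite (_ : [set t | _]%classic = Z n @^-1` [set p])%classic//.
rewrite -[X in measurable X]setTI; apply: measurable_walk => //.
case: p => x y; rewrite (_ : [set (x, y)] = [set x] `*` [set y])%classic.
  exact: measurableX.
by apply/seteqP; split=> [[u v] /= [-> ->]|[u v] /= [-> ->]].
Qed.

Lemma walk_step_eqE n p v : [set t | (Z n t, Z n.+1 t) = (p, v)]%classic =
  ([set t | Z n.+1 t = v] `&` [set t | Z n t = p])%classic.
Proof. by apply/seteqP; split=> t /= [-> ->]. Qed.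

Lemma measurable_walk_step_eq n u :
  measurable [set t | (Z n t, Z n.+1 t) = u]%classic.
Proof.
by case: u => p v; rewrite walk_step_eqE; apply: measurableI; exact: measurable_walk_eq.
Qed.

(** Null positions are treated apart: the transition hypothesis says nothing there, but both sides
    vanish. *)
Lemma probability_walk_step n r p : hex_vertices a (hex_class n) p ->
  fine (P [set t | (Z n t, Z n.+1 t) = (p, step n r p)]%classic) =
  q (hex_class n) r * fine (P [set t | Z n t = p]%classic).
Proof.
move=> Vp; rewrite walk_step_eqE.
have [P0|P0] := eqVneq (P [set t | Z n t = p]%classic) 0%E.
  rewrite P0 mulr0 (_ : P _ = 0%E)//.
  apply/eqP; rewrite -measure_le0 -P0 le_measure ?inE//.
    by apply: measurableI; exact: measurable_walk_eq.
  exact: measurable_walk_eq.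
have := hex_walk_transition XY_walk r Vp P0; rewrite /cond_prob => <-.
rewrite divfK// fine_eq0// fin_num_measure//; exact: measurable_walk_eq.
Qed.

Definition walk_pairs n (s : seq (R * R)) : seq ((R * R) * (R * R)) :=
  [seq (p, step n r p) | p <- s, r <- enum 'I_3].

Lemma walk_pairs_uniq n s : uniq s -> uniq (walk_pairs n s).
Proof.
move=> us; apply: allpairs_uniq => //; first exact: enum_uniq.
move=> [p r] [p' r'] _ _ /eqP; rewrite xpair_eqE => /andP[/eqP /= -> /eqP e].
by rewrite (hex_step_inj (lt0r_neq0 a_gt0) e).
Qed.

Lemma sum_walk_pairs n s (F : (R * R) * (R * R) -> R) :
  (forall p, p \in s -> hex_vertices a (hex_class n) p) ->
  \sum_(u <- walk_pairs n s)
     F u * fine (P [set t | (Z n t, Z n.+1 t) = u]%classic) =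
  \sum_(r < 3) q (hex_class n) r *
     \sum_(p <- s) F (p, step n r p) * fine (P [set t | Z n t = p]%classic).
Proof.
move=> Vs; rewrite /walk_pairs big_allpairs_dep /=.
under [RHS]eq_bigr do rewrite mulr_sumr.
rewrite [RHS]exchange_big /= !big_seq; apply: eq_bigr => p /Vs Vp.
rewrite big_enum /=; apply: eq_bigr => r _.
by rewrite probability_walk_step// mulrCA.
Qed.

Definition supported_on n (s : seq (R * R)) :=
  [/\ uniq s, forall p, p \in s -> hex_vertices a (hex_class n) p &
      P [set t | Z n t \in s]%classic = 1%E].

(** The listed moves have masses q times the mass of the position; these already sum to 1, leaving
    nothing for any other move. *)
Lemma probability_walk_pairs n s : supported_on n s ->
  P [set t | (Z n t, Z n.+1 t) \in walk_pairs n s]%classic = 1%E.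
Proof.
move=> [us Vs Ps].
have mS : measurable [set t | (Z n t, Z n.+1 t) \in walk_pairs n s]%classic.
  exact: (measurable_preimage_mem (measurable_walk_step_eq n)).
rewrite -[LHS]fineK ?fin_num_measure//; congr EFin.
rewrite (fine_probability_mem P (measurable_walk_step_eq n)) ?walk_pairs_uniq//.
under eq_bigr do rewrite -[fine _]mul1r.
rewrite (sum_walk_pairs (fun=> 1) Vs) -[RHS](q_sum1 (hex_class n)).
apply: eq_bigr => r _; rewrite -[RHS]mulr1; congr (_ * _).
under eq_bigr do rewrite /= mul1r.
by rewrite -(fine_probability_mem P (measurable_walk_eq n))// Ps.
Qed.

Lemma walk_support0 : supported_on 0 [:: (0, 0)].
Proof.
split=> //.
  move=> p; rewrite inE => /eqP ->; exists 0, 0.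
  by rewrite /hex_class /= !(mulr0, mul0r, addr0).
have m0 := measurable_preimage_mem (measurable_walk_eq 0) [:: (0, 0)].
have : P.-negligible (~` [set t | Z 0 t \in [:: (0, 0)]])%classic.
  apply: filterS (hex_walk_init XY_walk) => t /= Z0.
  by rewrite /Z Z0 inE.
move=> /(measure_negligible (measurableC m0)) P0.
by rewrite -[X in P X]setCK probability_setC ?P0 ?sube0//; exact: measurableC.
Qed.

Lemma walk_support n : exists s, supported_on n s.
Proof.
elim: n => [|n [s sP]]; first by exists [:: (0, 0)]; exact: walk_support0.
have [us Vs _] := sP.
(* The next support consists of the endpoints of the pairs: the event that the pair is listed has
   probability 1 and implies that the endpoint is. *)
exists (undup [seq u.2 | u <- walk_pairs n s]); split.
- exact: undup_uniq.
- move=> v; rewrite mem_undup => /mapP[u /allpairsP[[p r] /= [ps _ ->]] ->] /=.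
  exact/hex_step_class/Vs.
- apply/eqP; rewrite eq_le probability_le1/=; last first.
    exact: (measurable_preimage_mem (measurable_walk_eq n.+1)).
  rewrite -(probability_walk_pairs sP) le_measure ?inE//.
  + exact: (measurable_preimage_mem (measurable_walk_step_eq n)).
  + exact: (measurable_preimage_mem (measurable_walk_eq n.+1)).
  + by move=> t /= tS; rewrite mem_undup; apply/mapP; exists (Z n t, Z n.+1 t).
Qed.

Lemma measurable_hex_step i r : measurable_fun [set: R * R] (hex_step a i r).
Proof.
apply/measurable_fun_pair => /=; apply: measurable_funD => //.
Qed.

Lemma expectation_walk n (f : R * R -> R) : measurable_fun [set: R * R] f ->
  'E_P[f \o Z n]%E = (hex_mean a q n f)%:E.
Proof.
elim: n f => [|n IH] f mf.
  have [us _ Ps] := walk_support0.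
  have mf0 : measurable_fun [set: T] (f \o Z 0).
    exact: (measurableT_comp mf (measurable_walk 0)).
  rewrite (expectation_finite_support (measurable_walk_eq 0) us Ps mf0) big_seq1.
  have := fine_probability_mem P (measurable_walk_eq 0) us.
  by rewrite big_seq1 Ps => <-; rewrite mulr1.
have [s sP] := walk_support n; have [us Vs Ps] := sP.
have mfZ (g : R * R -> R) m : measurable_fun [set: R * R] g ->
    measurable_fun [set: T] (g \o Z m).
  by move=> mg; exact: (measurableT_comp mg (measurable_walk m)).
(* f(Z_{n+1}) is read as [f \o snd] on the pair of consecutive positions. Grouping by the last
   direction, each inner sum is an expectation at time n of [f] after that step, to which the
   induction hypothesis applies. *)
have := expectation_finite_support (measurable_walk_step_eq n) (f := f \o snd)
  (walk_pairs_uniq n us) (probability_walk_pairs sP) (mfZ _ n.+1 mf).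
rewrite (sum_walk_pairs _ Vs) => ->; congr EFin; apply: eq_bigr => r _; congr (_ * _).
apply: EFin_inj; rewrite -IH; last exact: (measurableT_comp mf (measurable_hex_step _ r)).
rewrite (expectation_finite_support (measurable_walk_eq n) us Ps)//.
by apply: mfZ; exact: (measurableT_comp mf (measurable_hex_step _ r)).
Qed.

End Walk.

(** * Covariances and closed forms *)

Lemma covariance_walk (R : realType) (a : R) (q : 'I_2 -> 'I_3 -> R)
    (d : measure_display) (T : measurableType d) (P : probability T R)
    (X Y : nat -> {RV P >-> R})
    (a_gt0 : 0 < a) (q_sum1 : forall i, \sum_(r < 3) q i r = 1)
    (XY_walk : hex_walk a q X Y) (n : nat) (f g : R * R -> R)
    (mf : measurable_fun [set: R * R] f) (mg : measurable_fun [set: R * R] g) :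
  covariance P (fun t => f (X n t, Y n t)) (fun t => g (X n t, Y n t)) =
  (hex_mean a q n
    (fun p => (f p - hex_mean a q n f) * (g p - hex_mean a q n g)))%:E.
Proof.
have E h := expectation_walk a_gt0 q_sum1 XY_walk n (f := h).
have F h (mh : measurable_fun [set: R * R] h) :
    fine 'E_P[fun t => h (X n t, Y n t)]%E = hex_mean a q n h by rewrite (E h mh).
by rewrite unlock (F _ mf) (F _ mg) -E//; apply: measurable_funM; apply: measurable_funB.
Qed.

Theorem proposition3p3 (R : realType) (a : R) (q : 'I_2 -> 'I_3 -> R)
    (d : measure_display) (T : measurableType d) (P : probability T R)
    (X Y : nat -> {RV P >-> R})
    (a_gt0 : 0 < a)
    (q_ge0 : forall i r, 0 <= q i r)
    (q_sum1 : forall i, \sum_(r < 3) q i r = 1)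
    (XY_walk : hex_walk a q X Y)
    (n : nat) (n_gt0 : (0 < n)%N) :
  let i_n : R := parity_coef R n in
  [/\ 'E_P[X n] = (mu1 a q * n%:R + theta1 a q * i_n)%:E,
      'E_P[Y n] = (mu2 a q * n%:R + theta2 a q * i_n)%:E,
      'V_P[X n] = (sigma1_sq a q * n%:R + theta3 a q * i_n)%:E,
      'V_P[Y n] = (sigma2_sq a q * n%:R + theta4 a q * i_n)%:E &
      covariance P (X n) (Y n) = (sigma12 a q * n%:R + theta5 a q * i_n)%:E]%E.
Proof.
move=> i_n; rewrite {}/i_n.
have s3 : Num.sqrt 3 ^+ 2 = 3 :> R by rewrite sqr_sqrtr.
have E f := expectation_walk a_gt0 q_sum1 XY_walk n (f := f).
have C f g := covariance_walk a_gt0 q_sum1 XY_walk n (f := f) (g := g).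
have mX : measurable_fun [set: R * R] (fun p : R * R => p.1) by exact: measurable_fst.
have mY : measurable_fun [set: R * R] (fun p : R * R => p.2) by exact: measurable_snd.
have stepX (i : 'I_2) (r : 'I_3) (p : R * R) :
    (hex_step a i r p).1 = p.1 + (-1) ^+ i * a * (hex_dir R r).1.
  by rewrite hex_stepE.
have stepY (i : 'I_2) (r : 'I_3) (p : R * R) :
    (hex_step a i r p).2 = p.2 + (-1) ^+ i * a * (hex_dir R r).2.
  by rewrite hex_stepE.
have sum3 (F : 'I_3 -> R) : \sum_(r < 3) F r = F 0 + F 1 + F 2.
  rewrite !big_ord_recl big_ord0 addr0 addrA.
  by congr (F _ + F _ + F _); exact: val_inj.
(* The stated coefficients involve only directions 1 and 2, so direction 0 is eliminated. *)
have q0 i : q i 0 = 1 - q i 1 - q i 2 by rewrite -(q_sum1 i) sum3; ring.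
have dir0 : hex_dir R 0 = (1, 0) by [].
have dir1 : hex_dir R 1 = (- (1 / 2), Num.sqrt 3 / 2) by [].
have dir2 : hex_dir R 2 = (- (1 / 2), - (Num.sqrt 3 / 2)) by [].
have sg0 : (-1) ^+ (0%R : 'I_2) = 1 :> R by [].
have sg1 : (-1) ^+ (1%R : 'I_2) = -1 :> R by [].
(* Horizontal and vertical increments out of class [i], followed by their means [m] and covariances
   [K]. *)
pose c (i : 'I_2) (r : 'I_3) := (-1) ^+ i * a * (hex_dir R r).1.
pose e (i : 'I_2) (r : 'I_3) := (-1) ^+ i * a * (hex_dir R r).2.
pose m k (i : 'I_2) := \sum_(r < 3) q i r * k i r : R.
pose K k l (i : 'I_2) := \sum_(r < 3) q i r * (k i r * l i r) - m k i * m l i.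
split.
- rewrite (E _ mX) (hex_mean_additive q_sum1 n stepX erefl); congr EFin.
  rewrite (sum_hex_class (m c)) /m /c !sum3 dir0 dir1 dir2 /=.
  by rewrite sg0 sg1 !q0 /mu1 /theta1; field.
- rewrite (E _ mY) (hex_mean_additive q_sum1 n stepY erefl); congr EFin.
  rewrite (sum_hex_class (m e)) /m /e !sum3 dir0 dir1 dir2 /=.
  by rewrite sg0 sg1 !q0 /mu2 /theta2; field.
(* The variance is by definition the covariance of a variable with itself. *)
- rewrite (C _ _ mX mX : 'V_P[X n]%E = _).
  rewrite (hex_mean_cov q_sum1 n stepX stepX erefl erefl); congr EFin.
  rewrite (sum_hex_class (K c c)) /K /m /c !sum3 dir0 dir1 dir2 /=.
  by rewrite sg0 sg1 !q0 /sigma1_sq /theta3; field.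
- rewrite (C _ _ mY mY : 'V_P[Y n]%E = _).
  rewrite (hex_mean_cov q_sum1 n stepY stepY erefl erefl); congr EFin.
  rewrite (sum_hex_class (K e e)) /K /m /e !sum3 dir0 dir1 dir2 /=.
  (* The vertical increments enter squared, so the identity holds modulo [s3]. *)
  by rewrite sg0 sg1 !q0 /sigma2_sq /theta4; field: s3.
- rewrite (C _ _ mX mY : covariance P (X n) (Y n) = _).
  rewrite (hex_mean_cov q_sum1 n stepX stepY erefl erefl); congr EFin.
  rewrite (sum_hex_class (K c e)) /K /m /c /e !sum3 dir0 dir1 dir2 /=.
  by rewrite sg0 sg1 !q0 /sigma12 /theta5; field.
Qed.
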